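(* Let $\mathcal{S}$ be a finite set of states, let $\gamma\in\mathbb{R}$ be the discount factor, and let $s,s'\in\mathcal{S}$ (the case $s'=s$ is allowed). Let $\hat{\mathcal{R}}_s\in\mathbb{R}$ be the estimated expected reward for $s$ and, for $s''\in\mathcal{S}$, let $\hat{\mathcal{P}}_s^{s''}\in\mathbb{R}$ be the estimated transition probability from $s$ to $s''$. Let $V:\mathcal{S}\to\mathbb{R}$ be the current state-value estimate and $U_s:\mathcal{S}\to\mathbb{R}$ the current function of successor-state values associated with $s$. Suppose that currently $$V(s)=\hat{\mathcal{R}}_s+\gamma\sum_{s''\in\mathcal{S}}\hat{\mathcal{P}}_s^{s''}\,U_s(s'').\qquad(\ast)$$ Perform, in this order, the assignments $$tmp\leftarrow V(s'),$$ $$V(s)\leftarrow V(s)+\gamma\,\hat{\mathcal{P}}_s^{s'}\,\bigl[V(s')-U_s(s')\bigr],$$ $$U_s(s')\leftarrow tmp.$$ Then, after these assignments, relation $(\ast)$ still holds for the new values of $V(s)$ and $U_s$, and the new value of $U_s(s')$ equals the value that $V(s')$ had before the assignments.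
   Context: The setting is model-based policy evaluation in reinforcement learning. $V(s)$ is an estimate of the expected discounted return from state $s$ under a fixed policy. $\hat{\mathcal{R}}_s$ and $\hat{\mathcal{P}}_s^{s''}$ are the current estimates of the expected reward in $s$ and of the transition probability from $s$ to $s''$ under that policy. For each state $s$, the function $U_s:\mathcal{S}\to\mathbb{R}$ stores the value estimates of successor states that are associated with $s$, so $U_s(s')$ is the value estimate of $s'$ associated with $s$. The notation $x\leftarrow e$ denotes assignment: the expression $e$ is evaluated with the current values of all variables and the result becomes the new value of $x$, while all other variables are unchanged. Assignments are executed sequentially. The three assignments in the claim together form what is called a small backup. The model estimates $\hat{\mathcal{R}}_s,\hat{\mathcal{P}}_s^{s''}$ and $\gamma$ are not changed by it. *)

(* Defs.v *)
From mathcomp Require Import all_boot all_order all_algebra.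
From mathcomp Require Import reals.

Set Implicit Arguments.
Unset Strict Implicit.
Unset Printing Implicit Defensive.

Import GRing.Theory Num.Theory.
Local Open Scope ring_scope.

(* Values of the program variables: [V] is the state-value estimate, [U x] the
   function U_x of successor-state values associated with x. The quantities
   gamma, Rhat and Phat are not assigned to, hence are parameters below. *)
Record store (R : realType) (S : finType) := Store {
  V : S -> R;
  U : S -> S -> R;
  tmp : R
}.

Definition update (T : eqType) (A : Type) (f : T -> A) (x : T) (a : A) : T -> A :=
  [eta f with x |-> a].

Section SmallBackup.
Variables (R : realType) (S : finType).
Implicit Types (st : store R S) (e : store R S -> R) (x y s : S).

(* Assignments tmp <- e, V(x) <- e and U_x(y) <- e: the expression [e] is
   evaluated in the store preceding the assignment. *)
Definition assign_tmp e st := Store (V st) (U st) (e st).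

Definition assign_V x e st :=
  Store (update (V st) x (e st)) (U st) (tmp st).

Definition assign_U x y e st :=
  Store (V st) (update (U st) x (update (U st x) y (e st))) (tmp st).

Variables (gamma : R) (Rhat : S -> R) (Phat : S -> S -> R).

Definition model_consistent s st :=
  V st s = Rhat s + gamma * \sum_(s2 : S) Phat s s2 * U st s s2.

(* [f \; g] runs [f] first. *)
Definition small_backup s s' : store R S -> store R S :=
  assign_tmp (fun st => V st s') \;
  assign_V s (fun st => V st s + gamma * Phat s s' * (V st s' - U st s s')) \;
  assign_U s s' (fun st => tmp st).

End SmallBackup.

(* Main.v *)
Require Import Defs.
From mathcomp Require Import all_boot all_order all_algebra.
From mathcomp Require Import reals.

Set Implicit Arguments.
Unset Strict Implicit.
Unset Printing Implicit Defensive.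

Local Open Scope ring_scope.

Import GRing.Theory.

(** The right side of the relation is affine in each entry of [U s]: by [sum_mul_update], storing
    the old [V s'] at [s'] shifts it by exactly the increment that the backup adds to [V s]. Since
    [tmp] keeps the old [V s'], the case [s' = s] needs no separate treatment. *)

Lemma sum_mul_update (R : pzRingType) (S : finType) (p f : S -> R) (x : S)
    (a : R) :
  \sum_y p y * update f x a y = \sum_y p y * f y + p x * (a - f x).
Proof.
rewrite /update (bigD1 x) //= [in RHS](bigD1 x) //= eqxx mulrBr.
rewrite [RHS]addrAC [p x * f x + _]addrC subrK; congr (_ + _).
by apply: eq_bigr => y /negPf ->.
Qed.

Theorem theorem3p1 (R : realType) (S : finType) (gamma : R)
    (Rhat : S -> R) (Phat : S -> S -> R) (s s' : S) (st : store R S)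
    (hst : model_consistent gamma Rhat Phat s st) :
  model_consistent gamma Rhat Phat s (small_backup gamma Phat s s' st) /\
  U (small_backup gamma Phat s s' st) s s' = V st s'.
Proof.
split; last by rewrite /= /update /= !eqxx /= eqxx.
(* Only the updates of [V] and [U] at [s] are unfolded; the inner one of [U st s] at [s'] stays
   folded to match [sum_mul_update]. *)
rewrite /model_consistent /= {1 2}/update /= !eqxx sum_mul_update hst.
by rewrite [in RHS]mulrDr addrA mulrA.
Qed.
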